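(* Assume the location-scale assumption holds and the losses $\ell(z,\eta)$ have subgaussian tails (equivalently, $\xi$ does). Then there exist $k_1>0$ and $k_2>0$ such that $$\big|\rho_{\mathbb{P}}(\ell(z,\eta))-\mathbb{E}[\rho_{\mathrm{LOOCV}}]\big|=\Omega\Big(\exp\big(k_1\sqrt{\mathrm{Var}(\ell(z,\eta))}\big)\Big)$$ and $$\big|\rho_{\mathbb{P}}(\ell(z,\eta))-\mathbb{E}[\rho_{\mathrm{LOOCV}}]\big|=\mathcal{O}\Big(\exp\big(k_2\mathrm{Var}(\ell(z,\eta))\big)\Big).$$
   Context: Fix a risk aversion parameter $\alpha>0$ and an integer $N\ge 2$. $\mathcal{Z}\subseteq\mathbb{R}^d$ is a set of decisions, $\eta$ is a random vector with law $\mathbb{P}$, and $\ell(z,\eta)$ is a real random loss for each $z\in\mathcal{Z}$. The entropic risk is $\rho_{\mathbb{P}}(X)=\frac1\alpha\log\mathbb{E}_{\mathbb{P}}[\exp(\alpha X)]$; equivalently $\rho_{\mathbb{P}}(X)=\inf_t\mathbb{E}_{\mathbb{P}}[h(t,X)]$ with $h(t,\zeta)=t+\frac1\alpha\exp(\alpha(\zeta-t))-\frac1\alpha$. Let $\hat\eta_1,\dots,\hat\eta_N$ be i.i.d. samples from $\mathbb{P}$, let $\hat{\mathbb{P}}_{N_{-i}}$ be the empirical distribution of the $N-1$ samples other than $\hat\eta_i$, and let $\hat t_{-i}$ be the minimizer of $t\mapsto\mathbb{E}_{\hat{\mathbb{P}}_{N_{-i}}}[h(t,\ell(z,\eta))]$.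 The leave-one-out cross-validation estimator is $$\rho_{\mathrm{LOOCV}}:=\frac1N\sum_{i=1}^N h(\hat t_{-i},\ell(z,\hat\eta_i)).$$ The expectation $\mathbb{E}$ in the claim is over the samples. Location-scale assumption: there are a fixed real random variable $\xi$ with $\mathbb{E}[\xi]=0$, $\mathbb{E}[\xi^2]=1$ and a set $\mathcal{A}\subset\mathbb{R}\times\mathbb{R}_+$ such that the set of distributions of $\{\ell(z,\eta):z\in\mathcal{Z}\}$ equals the set of distributions of $\{\mu+\sigma\xi:(\mu,\sigma)\in\mathcal{A}\}$. A random variable $X$ has subgaussian tails if there is $\mathfrak{c}_0>0$ with $\mathbb{P}(|X|\ge a)\le 2\exp(-a^2/\mathfrak{c}_0^2)$ for all $a\ge0$. Asymptotic notation: $\alpha$, $N$ and the law of $\xi$ are fixed, and quantities are considered as $\sigma=\sqrt{\mathrm{Var}(\ell(z,\eta))}$ varies. $f=\mathcal{O}(g(\sigma))$: there are $c,\bar\sigma>0$ with $f\le c\,g(\sigma)$ whenever $\sigma\ge\bar\sigma$. $f=\Omega(g(\sigma))$: there are $c,\bar\sigma>0$ with $c\,g(\sigma)\le f$ whenever $\sigma\ge\bar\sigma$. *)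

(* Defs.v *)
(* MathComp / MathComp-Analysis *)
From HB Require Import structures.
From mathcomp Require Import all_boot all_order all_algebra.
From mathcomp Require Import all_classical all_reals all_analysis.

Set Implicit Arguments.
Unset Strict Implicit.
Unset Printing Implicit Defensive.

Import Order.TTheory GRing.Theory Num.Theory.
Import numFieldNormedType.Exports.

Local Open Scope classical_set_scope.
Local Open Scope ring_scope.

Section Distributions.
Context {R : realType}.

(* A distribution is a function on the Borel sets only: the values that a
   measure takes on non-measurable sets are arbitrary, so comparing the bare
   [pushforward]s, which are total on [set R], would be too strong. *)
Definition borel_law {d} {T : measurableType d} (P : probability T R)
    (X : T -> R) : {B : set (measurableTypeR R) | measurable B} -> \bar R :=
  fun B => pushforward P X (sval B).

Definition location_scale {d dXi} {E : measurableType d}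
    {Xi : measurableType dXi} {D : Type} (P : probability E R)
    (Z : set D) (ell : D -> E -> R)
    (Pxi : probability Xi R) (xi : Xi -> R) (A : set (R * R)) : Prop :=
  [/\ ('E_Pxi[xi] = 0)%E, ('E_Pxi[xi ^+ 2] = 1)%E,
      (forall a, A a -> 0 <= a.2) &
      [set borel_law P (ell z) | z in Z] =
      [set borel_law Pxi (fun w => a.1 + a.2 * xi w) | a in A]].

Definition subgaussian_tails {d} {T : measurableType d} (P : probability T R)
    (X : T -> R) : Prop :=
  exists2 c0 : R, 0 < c0 & forall a : R, 0 <= a ->
    (P [set w | (a <= `|X w|)%R] <= (2 * expR (- (a ^+ 2 / c0 ^+ 2)))%:E)%E.

(* Independence of subfamilies follows by taking the other [B i] to be [setT]. *)
Definition iid_samples {d dS} {E : measurableType d} {S : measurableType dS}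
    (P : probability E R) (Q : probability S R) (N : nat)
    (etah : 'I_N -> {RV Q >-> E}) : Prop :=
  (forall i B, measurable B -> distribution Q (etah i) B = P B) /\
  (forall B : 'I_N -> set E, (forall i, measurable (B i)) ->
     Q (\bigcap_i (etah i @^-1` B i)) = (\prod_i Q (etah i @^-1` B i))%E).

End Distributions.

Section LeaveOneOutEmpirical.
Local Open Scope ereal_scope.
Context {R : realType} {d} {E : measurableType d} {N : nat}.
Variables (x : 'I_N -> E) (i : 'I_N).

Definition loo_empirical (B : set E) : \bar R :=
  (N.-1%:R^-1)%:E * \sum_(j < N | j != i) \d_(x j) B.

Let loo_empirical0 : loo_empirical set0 = 0.
Proof. by rewrite /loo_empirical big1 ?mule0// => j _; rewrite measure0. Qed.

Let loo_empirical_ge0 B : 0 <= loo_empirical B.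
Proof.
by rewrite /loo_empirical mule_ge0 ?sume_ge0// lee_fin invr_ge0 ler0n.
Qed.

Let loo_empirical_sigma_additive : semi_sigma_additive loo_empirical.
Proof.
have r0 : (0 <= N.-1%:R^-1 :> R)%R by rewrite invr_ge0 ler0n.
pose m k : {measure set E -> \bar R} :=
  if insub k is Some j then if j != i then [the measure _ _ of \d_(x j)]
                            else mzero else mzero.
have -> : loo_empirical = mscale (NngNum r0) (msum m N).
  apply/funext => B; rewrite /loo_empirical /mscale /msum/= big_mkcond/=.
  congr (_ * _); apply: eq_bigr => j _; rewrite /m valK.
  by case: ifP.
exact: measure_semi_sigma_additive.
Qed.

HB.instance Definition _ := isMeasure.Build _ _ _ loo_empirical
  loo_empirical0 loo_empirical_ge0 loo_empirical_sigma_additive.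

Lemma loo_empirical_setT : (2 <= N)%N -> loo_empirical setT = 1.
Proof.
move=> N2; rewrite /loo_empirical.
under eq_bigr do rewrite diracT.
rewrite sumEFin -EFinM sumr_const cardC1 card_ord mulVf//.
by rewrite pnatr_eq0; case: N N2 => [|[]].
Qed.

End LeaveOneOutEmpirical.

Section Risk.
Context {R : realType}.
Variable alpha : R.

(* Extended-real valued, so that no value is assigned by convention when the
   exponential moment is infinite. *)
Definition entropic_risk {d} {T : measurableType d} (P : probability T R)
    (X : T -> R) : \bar R :=
  ((alpha^-1)%:E * lne 'E_P[fun w => expR (alpha * X w)])%E.

Definition oce_loss (t zeta : R) : R :=
  t + alpha^-1 * expR (alpha * (zeta - t)) - alpha^-1.

Definition argmin (F : R -> R) : R := xget 0 [set t | forall s, F t <= F s].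

Definition loo_t {d} {E : measurableType d} {N : nat} (X : E -> R)
    (x : 'I_N -> E) (i : 'I_N) : R :=
  argmin (fun t => \int[loo_empirical x i]_w oce_loss t (X w)).

Definition rho_loocv {d} {E : measurableType d} {N : nat} (X : E -> R)
    (x : 'I_N -> E) : R :=
  N%:R^-1 * \sum_(i < N) oce_loss (loo_t X x i) (X (x i)).

End Risk.

(* Main.v *)
Require Import Defs.
From HB Require Import structures.
From mathcomp Require Import all_boot all_order all_algebra.
From mathcomp Require Import all_classical all_reals all_analysis.
From mathcomp Require Import measurable_realfun.
From mathcomp Require Import lra ring.

Set Implicit Arguments.
Unset Strict Implicit.
Unset Printing Implicit Defensive.

Import Order.TTheory GRing.Theory Num.Theory.
Import numFieldNormedType.Exports.

Local Open Scope classical_set_scope.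
Local Open Scope ring_scope.

(** The leave-one-out minimizer is explicit, t_{-i} = ln M_i / alpha with M_i
    the mean of exp(alpha X_j) over the other samples, so that
      alpha h(t_{-i}, X_i) = ln M_i + exp(alpha X_i) / M_i - 1.
    Writing X_j = mu + sigma zeta_j, where the zeta_j have the law of xi, and
    s = alpha sigma, both the entropic risk and the estimator are translated by
    mu; hence alpha times the gap is | ln m - L |, where m = E exp(s xi) and L
    is the expectation of the leave-one-out loss of the sample (s zeta_j).

    From here on M_i denotes the mean of exp(s zeta_j) over j distinct from i.

    Lower bound ([loo_gap_ge]).  Since xi is centred and not constant, it
    satisfies xi <= - a with probability q > 0 for some a > 0.  When all the
    other samples satisfy zeta_j <= - a, which has probability q ^ (N - 1) and
    is independent of zeta_i, one has 1 / M_i >= exp(s a).  The ratio therefore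
    contributes at least m q ^ (N - 1) exp(s a) to L, while ln M_i has an
    expectation bounded below by a constant because it dominates
    s zeta_j - ln (N - 1) for any j distinct from i.  As ln m <= m - 1 and
    m >= 1, the entropic risk cannot compensate a multiple of m that grows like
    exp(alpha a sigma).

    Upper bound ([loo_gap_le]).  Every term is at most a constant times the sum
    of the exp(2 s |zeta_j|), and subgaussian tails make exp(e xi^2) integrable
    for some e > 0 ([subgaussian_sqr_exp]), so that
    E exp(2 s |xi|) <= K exp(s^2 / e) by completing the square.  Applying the
    tail hypothesis to one non-degenerate loss is enough: the constants e and K
    obtained in this way depend on the law of xi only. *)

(** * Equality in law and independence from an event *)

Definition same_law {R : realType} {d d'} {T : measurableType d}
    {T' : measurableType d'} (P : probability T R) (X : T -> R)
    (Q : probability T' R) (Y : T' -> R) : Prop :=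
  forall B : set R, measurable B -> P (X @^-1` B) = Q (Y @^-1` B).

Section SameLaw.
Context {R : realType} {d d'} {T : measurableType d} {T' : measurableType d'}.
Variables (P : probability T R) (X : T -> R).
Variables (Q : probability T' R) (Y : T' -> R).
Hypotheses (mX : measurable_fun setT X) (mY : measurable_fun setT Y).
Hypothesis XY : same_law P X Q Y.

Lemma same_law_ge0_integral (f : R -> \bar R) :
  measurable_fun setT f -> (forall x, 0 <= f x)%E ->
  (\int[P]_w f (X w) = \int[Q]_w f (Y w))%E.
Proof.
move=> mf f0.
have := @ge0_integral_pushforward _ _ _ _ _ _ mX P setT f measurableT mf
  (fun x _ => f0 x).
have := @ge0_integral_pushforward _ _ _ _ _ _ mY Q setT f measurableT mf
  (fun x _ => f0 x).
rewrite !preimage_setT /comp => <- <-.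
by apply: eq_measure_integral => B mB _; exact: XY.
Qed.

Lemma same_law_integral (f : R -> \bar R) : measurable_fun setT f ->
  (\int[P]_w f (X w) = \int[Q]_w f (Y w))%E.
Proof.
move=> mf; rewrite integralE [in RHS]integralE.
rewrite (funepos_comp f X) (funepos_comp f Y).
rewrite (funeneg_comp f X) (funeneg_comp f Y); congr (_ - _)%E.
- exact: (same_law_ge0_integral (measurable_funepos mf) (funepos_ge0 f)).
- exact: (same_law_ge0_integral (measurable_funeneg mf) (funeneg_ge0 f)).
Qed.

End SameLaw.

Section IndependentEvent.
Context {R : realType} {d} {S : measurableType d} (Q : probability S R).

(** The image by [X] of [Q] restricted to [B] is [Q B] times the law of [X]:
    integrating [f] against both gives the formula, without any product
    measure. *)
Lemma integral_indep_event (X : S -> R) (B : set S) (f : R -> \bar R) :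
  measurable_fun setT X -> measurable B ->
  measurable_fun setT f -> (forall x, 0 <= f x)%E ->
  (forall A : set R, measurable A ->
    Q ((X @^-1` A) `&` B) = Q (X @^-1` A) * Q B)%E ->
  (\int[Q]_(w in B) f (X w) = (\int[Q]_w f (X w)) * Q B)%E.
Proof.
move=> mX mB mf f0 indep.
pose b : {nonneg R} := NngNum (fine_ge0 (measure_ge0 Q B)).
have QB : Q B = (b%:num)%:E by rewrite /= fineK// fin_num_measure.
transitivity (\int[mrestr Q mB]_w f (X w))%E.
  rewrite -(setUv B) ge0_integral_setU//.
  - rewrite [X in (_ + X)%E](eq_measure_integral mzero) => [|A mA AB].
      rewrite integral_measure_zero adde0; apply: eq_measure_integral => A mA AB.
      by rewrite /= /mrestr setIidl.
    by rewrite /= /mrestr (_ : A `&` B = set0) ?measure0//; apply/disjoints_subset.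
  - exact: measurableC.
  - by rewrite setUv; exact: measurableT_comp.
  - by rewrite disj_set2E setICr.
have := @ge0_integral_pushforward _ _ _ _ _ _ mX Q setT f measurableT mf
  (fun x _ => f0 x).
have := @ge0_integral_pushforward _ _ _ _ _ _ mX (mrestr Q mB) setT f
  measurableT mf (fun x _ => f0 x).
rewrite !preimage_setT /comp => <- <-.
rewrite QB muleC -ge0_integral_mscale//.
apply: eq_measure_integral => A mA _.
by rewrite /= /mscale /pushforward /mrestr indep// QB muleC.
Qed.

End IndependentEvent.

(** * The leave-one-out loss of a fixed sample *)

Section LooEmpirical.
Context {R : realType} {d} {E : measurableType d} {N : nat}.
Variables (x : 'I_N -> E) (i : 'I_N).

Lemma ge0_integral_loo_empirical (f : E -> \bar R) :
  measurable_fun setT f -> (forall w, 0 <= f w)%E ->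
  (\int[loo_empirical x i]_w f w =
   (N.-1%:R^-1)%:E * \sum_(j < N | j != i) f (x j))%E.
Proof.
move=> mf f0.
have r0 : (0 <= N.-1%:R^-1 :> R)%R by rewrite invr_ge0 ler0n.
pose m k : {measure set E -> \bar R} :=
  if insub k is Some j then if j != i then [the measure _ _ of \d_(x j)]
                            else mzero else mzero.
transitivity (\int[mscale (NngNum r0) (msum m N)]_w f w)%E.
  apply: eq_measure_integral => B mB _.
  rewrite /= /mscale/=; congr (_ * _)%E.
  rewrite /loo_empirical /msum big_mkcond/=; apply: eq_bigr => j _.
  by rewrite /m valK; case: ifP.
rewrite ge0_integral_mscale// ge0_integral_measure_sum//.
congr (_ * _)%E; rewrite [RHS]big_mkcond/=; apply: eq_bigr => j _.
rewrite /m valK.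
case: ifP => _; last by rewrite integral_measure_zero.
by rewrite integral_dirac// diracT mul1e.
Qed.

Lemma Rintegral_loo_empirical (f : E -> R) : measurable_fun setT f ->
  \int[loo_empirical x i]_w f w = N.-1%:R^-1 * \sum_(j < N | j != i) f (x j).
Proof.
move=> mf; have mEf : measurable_fun setT (EFin \o f) by exact/measurable_EFinP.
rewrite /Rintegral integralE.
rewrite !ge0_integral_loo_empirical//; last 2 first.
- exact: measurable_funeneg.
- exact: measurable_funepos.
have -> : (\sum_(j < N | j != i) (EFin \o f)^\+ (x j) =
           (\sum_(j < N | j != i) Num.max (f (x j)) 0)%:E)%E.
  by rewrite -sumEFin; apply: eq_bigr => j _; rewrite funeposE -EFin_max.
have -> : (\sum_(j < N | j != i) (EFin \o f)^\- (x j) =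
           (\sum_(j < N | j != i) Num.max (- f (x j)) 0)%:E)%E.
  by rewrite -sumEFin; apply: eq_bigr => j _; rewrite funenegE -EFin_max.
rewrite -!EFinM /= -mulrBr -sumrB; congr (_ * _).
apply: eq_bigr => j _; rewrite /Num.max; have := ltrgtP (f (x j)) 0.
by rewrite oppr_lt0; case=> [? | ? | ->]; rewrite ?ltxx ?subr0 ?sub0r ?opprK.
Qed.

End LooEmpirical.

Section Loss.
Context {R : realType} {N : nat}.
Implicit Types (y : 'I_N -> R) (i : 'I_N).

Definition loo_mean_exp y i : R :=
  N.-1%:R^-1 * \sum_(j < N | j != i) expR (y j).

(** This is [alpha * oce_loss alpha t (X i)] at the minimizer [t] for the other
    samples, expressed in the scaled losses [y j = alpha * X j]; see
    [rho_loocvE]. *)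
Definition loo_loss y i : R :=
  ln (loo_mean_exp y i) + expR (y i) / loo_mean_exp y i - 1.

Lemma loo_mean_exp_shift c y i :
  loo_mean_exp (fun j => c + y j) i = expR c * loo_mean_exp y i.
Proof.
rewrite /loo_mean_exp mulrCA; congr (_ * _); rewrite mulr_sumr.
by apply: eq_bigr => j _; rewrite expRD.
Qed.

Hypothesis N_ge2 : (2 <= N)%N.

Let N1_ge1 : 1 <= N.-1%:R :> R.
Proof. by rewrite ler1n; case: N N_ge2 => [|[]]. Qed.

Let N1_gt0 : 0 < N.-1%:R :> R.
Proof. exact: lt_le_trans N1_ge1. Qed.

Lemma other_index i : exists j, j != i.
Proof.
have : (0 < #|predC1 i|)%N by rewrite cardC1 card_ord; case: N N_ge2 => [|[]].
by case/card_gt0P => j; exists j.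
Qed.

Lemma le_loo_mean_exp y i j : j != i ->
  N.-1%:R^-1 * expR (y j) <= loo_mean_exp y i.
Proof.
by move=> ji; rewrite ler_pM2l ?invr_gt0// (bigD1 j)//= lerDl sumr_ge0.
Qed.

Lemma loo_mean_exp_gt0 y i : 0 < loo_mean_exp y i.
Proof.
have [j ji] := other_index i; apply: lt_le_trans (le_loo_mean_exp y ji).
by rewrite mulr_gt0 ?invr_gt0 ?expR_gt0.
Qed.

Lemma loo_loss_shift c y i : loo_loss (fun j => c + y j) i = c + loo_loss y i.
Proof.
have M0 := loo_mean_exp_gt0 y i; have e0 := expR_gt0 c.
rewrite /loo_loss loo_mean_exp_shift lnM ?posrE// expRK expRD.
rewrite -mulf_div divff ?gt_eqF//.
by rewrite mul1r !addrA.
Qed.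

(** A mean dominates any one of its terms divided by their number, and
    [ln (N - 1) <= N - 2]. *)
Lemma ln_loo_mean_exp_ge y i j : j != i ->
  y j - N.-1%:R + 1 <= ln (loo_mean_exp y i).
Proof.
move=> ji; have M0 := loo_mean_exp_gt0 y i.
apply: (@le_trans _ _ (ln (N.-1%:R^-1 * expR (y j)))); last first.
  by rewrite ler_ln ?posrE// ?le_loo_mean_exp// mulr_gt0 ?invr_gt0 ?expR_gt0.
rewrite lnM ?posrE ?invr_gt0 ?expR_gt0// expRK lnV ?posrE//.
have := @le_ln1Dx R (N.-1%:R - 1); rewrite [1 + _]addrC subrK => lnN.
have : ln N.-1%:R <= N.-1%:R - 1 :> R by apply: lnN; have := N1_gt0; lra.
lra.
Qed.

(** When all the other entries are at most [- b], their exponential mean is at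
    most [exp (- b)], so the ratio in the loss is at least
    [exp (y i) * exp b]. *)
Lemma loo_loss_ge y i j (b : R) : j != i ->
  y j - N%:R + expR (y i) *
    (if [forall k, (k != i) ==> (y k <= - b)] then expR b else 0)
  <= loo_loss y i.
Proof.
move=> ji; have M0 := loo_mean_exp_gt0 y i; have lnM := ln_loo_mean_exp_ge y ji.
have NE : N%:R = N.-1%:R + 1 :> R by rewrite natr1; case: N N_ge2.
suff : expR (y i) *
    (if [forall k, (k != i) ==> (y k <= - b)] then expR b else 0)
    <= expR (y i) / loo_mean_exp y i by rewrite /loo_loss; lra.
apply: ler_wpM2l; first exact: expR_ge0.
case: ifPn => [/forallP yb|_]; last by rewrite invr_ge0 ltW.
rewrite -[expR b]invrK -expRN lef_pV2 ?posrE ?expR_gt0//.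
rewrite /loo_mean_exp mulrC ler_pdivrMr//.
apply: (@le_trans _ _ (\sum_(k < N | k != i) expR (- b))).
  by apply: ler_sum => k ki; rewrite ler_expR (implyP (yb k)).
by rewrite sumr_const cardC1 card_ord mulr_natr.
Qed.

(** The ratio is at most [(N - 1) * exp (y i - y j)], and [y i - y j] is at most
    twice the larger of the two absolute values. *)
Lemma loo_loss_abs_le y i :
  `|loo_loss y i| <= (N%:R + 3) * \sum_j expR (2 * `|y j|).
Proof.
set G := \sum_j _.
have M0 := loo_mean_exp_gt0 y i; have N1 := N1_ge1.
have e_ge1 j : 1 <= expR (2 * `|y j|).
  by rewrite -expR0 ler_expR mulr_ge0.
have leG j : expR (2 * `|y j|) <= G.
  by rewrite /G (bigD1 j)//= lerDl sumr_ge0// => k _; exact: expR_ge0.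
have NG : N%:R <= G.
  rewrite -[N in N%:R]card_ord -sumr_const; apply: ler_sum => j _; exact: e_ge1.
have NE : N%:R = N.-1%:R + 1 :> R by rewrite natr1; case: N N_ge2.
have G1 : 1 <= G by lra.
have [j ji] := other_index i.
have absG k : 1 + 2 * `|y k| <= G by exact: le_trans (expR_ge1Dx _) (leG k).
have lnlo : - (G + G) <= ln (loo_mean_exp y i).
  have := ln_loo_mean_exp_ge y ji; have := absG j; have := ler_norm (- y j).
  by rewrite normrN; lra.
have lnhi : ln (loo_mean_exp y i) <= G.
  apply: (@le_trans _ _ (loo_mean_exp y i)); first exact/ltW/ln_sublinear.
  rewrite /loo_mean_exp mulrC ler_pdivrMr//.
  apply: (@le_trans _ _ G); last by rewrite ler_peMr; lra.
  rewrite /G [in leRHS](bigID (fun k => k != i))/= -[leLHS]addr0 lerD//.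
    apply: ler_sum => k _; rewrite ler_expR.
    by have := ler_norm (y k); have := normr_ge0 (y k); lra.
  by apply: sumr_ge0 => k _; exact: expR_ge0.
have ratio : expR (y i) / loo_mean_exp y i <= N.-1%:R * G.
  rewrite ler_pdivrMr//.
  apply: (@le_trans _ _ (N.-1%:R * G * (N.-1%:R^-1 * expR (y j)))); last first.
    by rewrite ler_pM2l ?le_loo_mean_exp// mulr_gt0//; lra.
  rewrite mulrACA divff ?gt_eqF// mul1r -ler_pdivrMr ?expR_gt0// -expRB.
  have [yij|yij] := leP `|y i| `|y j|.
    apply: le_trans (leG j); rewrite ler_expR.
    by have := ler_norm (y i); have := ler_norm (- y j); rewrite normrN; lra.
  apply: le_trans (leG i); rewrite ler_expR.
  by have := ler_norm (y i); have := ler_norm (- y j); rewrite normrN; lra.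
have ratio0 : 0 <= expR (y i) / loo_mean_exp y i.
  by rewrite divr_ge0 ?expR_ge0// ltW.
by rewrite /loo_loss NE ler_norml; apply/andP; split; nra.
Qed.

End Loss.

Section LooLoss.
Context {R : realType} (alpha : R) (alpha_gt0 : 0 < alpha).
Context {d} {E : measurableType d} {N : nat} (N_ge2 : (2 <= N)%N).
Variables (X : E -> R) (mX : measurable_fun setT X) (x : 'I_N -> E).
Let y j := alpha * X (x j).

(** The objective exceeds its value at [ln M / alpha] by
    [(exp u - (1 + u)) / alpha], which vanishes at [u = 0] only. *)
Lemma argmin_oce_loss (M : R) : 0 < M ->
  argmin (fun t => t + alpha^-1 * (expR (- (alpha * t)) * M) - alpha^-1) =
  alpha^-1 * ln M.
Proof.
move=> M0.
have a0 : alpha != 0 by rewrite gt_eqF.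
pose u t := ln M - alpha * t.
have FE t : t + alpha^-1 * (expR (- (alpha * t)) * M) - alpha^-1 =
    alpha^-1 * ln M + alpha^-1 * (expR (u t) - (1 + u t)).
  rewrite /u expRD lnK ?posrE// [M * _]mulrC.
  by field.
have u0 : u (alpha^-1 * ln M) = 0 by rewrite /u mulrA divff// mul1r subrr.
have F0 : alpha^-1 * (expR (u (alpha^-1 * ln M)) - (1 + u (alpha^-1 * ln M))) = 0.
  by rewrite u0 expR0 addr0 subrr mulr0.
rewrite /argmin; under eq_fun do rewrite FE.
apply: xget_unique => [s|t /(_ (alpha^-1 * ln M))].
  rewrite F0 FE lerD2l mulr_ge0 ?invr_ge0 ?(ltW alpha_gt0)//.
  by rewrite subr_ge0 expR_ge1Dx.
rewrite FE F0 lerD2l.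
rewrite pmulr_rle0 ?invr_gt0// subr_le0 => ut.
have /eqP : u t = 0.
  by apply/eqP; apply: contraTT ut => /expR_gt1Dx; rewrite -ltNge.
by rewrite /u subr_eq0 => /eqP ->; rewrite mulKf.
Qed.

Lemma loo_tE i : loo_t alpha X x i = alpha^-1 * ln (loo_mean_exp y i).
Proof.
rewrite -argmin_oce_loss ?loo_mean_exp_gt0// /loo_t; congr argmin; apply/funext => t.
have moce : measurable_fun setT (fun w => oce_loss alpha t (X w)).
  rewrite /oce_loss; apply: measurable_funB => //; apply: measurable_funD => //.
  apply: measurable_funM => //; apply: measurableT_comp => //.
  by apply: measurable_funM => //; exact: measurable_funB.
rewrite Rintegral_loo_empirical// /oce_loss /loo_mean_exp.
have N1 : N.-1%:R != 0 :> R by rewrite pnatr_eq0; case: N N_ge2 => [|[]].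
rewrite sumrB big_split/= !sumr_const cardC1 card_ord.
rewrite !mulrBr !mulrDr -[t *+ _]mulr_natl -[alpha^-1 *+ _]mulr_natl !mulKf//.
congr (_ + _ - _); rewrite -mulr_sumr mulrCA; congr (_ * _).
rewrite [RHS]mulrCA; congr (_ * _); rewrite mulr_sumr; apply: eq_bigr => j _.
by rewrite -expRD /y mulrBr addrC.
Qed.

Lemma rho_loocvE :
  rho_loocv alpha X x = alpha^-1 * (N%:R^-1 * \sum_(i < N) loo_loss y i).
Proof.
rewrite /rho_loocv mulrCA; congr (_ * _); rewrite mulr_sumr.
apply: eq_bigr => i _; rewrite /oce_loss loo_tE /loo_loss.
rewrite [RHS]mulrBr [in RHS]mulrDr mulr1.
congr (_ + _ * _ - _).
rewrite mulrBr mulrA divff ?gt_eqF// mul1r expRD expRN lnK//.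
by rewrite posrE loo_mean_exp_gt0.
Qed.

End LooLoss.

(** * Exponential moments *)

Section SubGaussian.
Context {R : realType} {d} {T : measurableType d} (P : probability T R).
Local Open Scope ereal_scope.

Definition sqr_exp_integrable (X : T -> R) (e : R) :=
  \int[P]_w (expR (e * X w ^+ 2))%:E < +oo.

(** With [W = X^2 / c^2], the tail hypothesis reads [P (k <= W) <= 2 exp (- k)],
    and [exp (W / 2)] is at most the sum over [k] of [exp ((k + 1) / 2)] on the
    events [k <= W]; its integral is therefore bounded by a geometric series of
    ratio [exp (- 1 / 2)]. *)
Lemma subgaussian_sqr_exp (X : T -> R) : measurable_fun setT X ->
  subgaussian_tails P X -> exists2 e : R, (0 < e)%R & sqr_exp_integrable X e.
Proof.
move=> mX [c c0 tail].
exists ((2 * c ^+ 2)^-1)%R; first by rewrite invr_gt0 mulr_gt0// exprn_gt0.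
pose W w := (X w ^+ 2 / c ^+ 2)%R.
have mW : measurable_fun setT W.
  by apply: measurable_funM => //; exact: measurable_funX.
pose B (k : nat) := [set w | (k%:R <= W w)%R].
have mB k : measurable (B k).
  by rewrite /B -[X in measurable X]setTI; exact: measurable_fun_ler.
pose f (k : nat) (w : T) : \bar R := (expR ((k%:R + 1) / 2) * \1_(B k) w)%:E.
have f0 k w : 0 <= f k w.
  by rewrite lee_fin mulr_ge0 ?expR_ge0.
have mf k : measurable_fun setT (f k).
  by apply/measurable_EFinP; apply: measurable_funM.
have Xf w : (expR ((2 * c ^+ 2)^-1 * X w ^+ 2))%:E <=
    \sum_(0 <= k <oo) f k w.
  have W0 : (0 <= W w)%R by rewrite divr_ge0 ?sqr_ge0.
  have /andP[kW Wk] := truncn_itv W0.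
  (* The single term of index the integer part of W already suffices. *)
  set k := Num.truncn (W w) in kW Wk.
  apply: le_trans (nneseries_lim_ge k.+1 _) => [|n _ _]; last exact: f0.
  rewrite big_nat_recr//=; apply: le_trans (leeDr _ _); last exact: sume_ge0.
  rewrite /f indicE mem_set// mulr1 lee_fin ler_expR.
  have -> : ((2 * c ^+ 2)^-1 * X w ^+ 2 = W w / 2)%R.
    by rewrite /W invfM; ring.
  by rewrite ler_pM2r// ltW// natr1.
rewrite /sqr_exp_integrable.
apply: (@le_lt_trans _ _ (\int[P]_w \sum_(k <oo) f k w)).
  apply: ge0_le_integral => //.
  - apply/measurable_EFinP; apply: measurableT_comp => //.
    by apply: measurable_funM => //; exact: measurable_funX.
  - exact: ge0_emeasurable_sum.
rewrite integral_nneseries//.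
pose z := expR (- (1 / 2)) : R.
have z0 : (0 < z)%R by exact: expR_gt0.
have z1 : (z < 1)%R by rewrite expR_lt1; lra.
pose a := (2 * expR (1 / 2))%R : R.
have fk k : \int[P]_w f k w <= (geometric a z k)%:E.
  rewrite /f; under eq_integral do rewrite EFinM.
  rewrite ge0_integralZl_EFin ?expR_ge0//; last exact/measurable_EFinP.
  rewrite integral_indic// setIT.
  have BE : B k = [set w | (c * Num.sqrt k%:R <= `|X w|)%R].
    apply/funext => w; rewrite /B /W/= ler_pdivlMr ?exprn_gt0//.
    rewrite -[in RHS](@ler_pXn2r _ 2%N) ?nnegrE ?mulr_ge0 ?sqrtr_ge0 ?(ltW c0)//.
    by rewrite exprMn sqr_sqrtr// real_normK ?num_real// mulrC.
  rewrite BE; apply: le_trans (lee_wpmul2l _ (tail _ _)) _.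
  - by rewrite lee_fin expR_ge0.
  - by rewrite mulr_ge0 ?sqrtr_ge0 ?ltW.
  rewrite -EFinM lee_fin exprMn sqr_sqrtr// mulrAC divff ?mul1r; last first.
    by rewrite sqrf_eq0 gt_eqF.
  rewrite /geometric /= /a /z -expRM_natl mulrCA -!mulrA.
  rewrite ler_pM2l// -!expRD ler_expR; lra.
apply: (@le_lt_trans _ _ (a * (1 - z)^-1)%:E); last exact: ltry.
apply: lime_le.
  by apply: is_cvg_nneseries => k _ _; apply: integral_ge0 => w _.
apply: nearW => n.
apply: (@le_trans _ _ (\sum_(0 <= k < n) (geometric a z k)%:E)).
  by apply: lee_sum => k _; exact: fk.
rewrite sumEFin lee_fin.
have := @geometric_le_lim R n a z; rewrite /series/=; apply => //.
  by rewrite mulr_ge0// expR_ge0.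
by rewrite ger0_norm// ltW.
Qed.

End SubGaussian.

Section Moments.
Context {R : realType} {d} {T : measurableType d} (P : probability T R).
Local Open Scope ereal_scope.

(** Pointwise, [s * |x| <= e * x^2 + s^2 / (4 * e)]. *)
Lemma exp_abs_moment_le (X : T -> R) (e s : R) :
  measurable_fun setT X -> (0 < e)%R ->
  \int[P]_w (expR (s * `|X w|))%:E <=
  (expR (s ^+ 2 / (4 * e)))%:E * \int[P]_w (expR (e * X w ^+ 2))%:E.
Proof.
move=> mX e0.
have me : measurable_fun setT (fun w => (expR (e * X w ^+ 2))%:E).
  apply/measurable_EFinP; apply: measurableT_comp => //.
  by apply: measurable_funM => //; exact: measurable_funX.
rewrite -ge0_integralZl_EFin ?expR_ge0//.
apply: ge0_le_integral => //.
- apply/measurable_EFinP; apply: measurableT_comp => //.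
  by apply: measurable_funM => //; exact: measurableT_comp.
- exact: emeasurable_funM.
- move=> w _; rewrite -EFinM lee_fin -expRD ler_expR.
  rewrite -[(X w ^+ 2)%R]real_normK ?num_real//.
  set x := (`|X w|)%R.
  have -> : (s ^+ 2 / (4 * e) + e * x ^+ 2 =
             s * x + e * (x - s / (2 * e)) ^+ 2)%R.
    by field; rewrite gt_eqF.
  by rewrite lerDl mulr_ge0 ?sqr_ge0 ?ltW.
Qed.

(** Since [(s x)^2 <= 2 m^2 + 2 (m + s x)^2]. *)
Lemma sqr_exp_integrable_affine (X : T -> R) (e m s : R) :
  measurable_fun setT X -> (0 < s)%R -> (0 < e)%R ->
  sqr_exp_integrable P (fun w => m + s * X w)%R e ->
  sqr_exp_integrable P X (e * s ^+ 2 / 2)%R.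
Proof.
move=> mX s0 e0; rewrite /sqr_exp_integrable => fin.
have mY : measurable_fun setT (fun w => (expR (e * (m + s * X w) ^+ 2))%:E).
  apply/measurable_EFinP; apply: measurableT_comp => //.
  apply: measurable_funM => //; apply: measurable_funX.
  by apply: measurable_funD => //; exact: measurable_funM.
apply: (@le_lt_trans _ _ ((expR (e * m ^+ 2))%:E *
    \int[P]_w (expR (e * (m + s * X w) ^+ 2))%:E)); last first.
  by rewrite lte_mul_pinfty// lee_fin expR_ge0.
rewrite -ge0_integralZl_EFin ?expR_ge0//.
apply: ge0_le_integral => //.
- apply/measurable_EFinP; apply: measurableT_comp => //.
  by apply: measurable_funM => //; exact: measurable_funX.
- exact: emeasurable_funM.
- move=> w _; rewrite -EFinM lee_fin -expRD ler_expR -subr_ge0.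
  have -> : (e * m ^+ 2 + e * (m + s * X w) ^+ 2 - e * s ^+ 2 / 2 * X w ^+ 2 =
             e * ((s * X w + 2 * m) ^+ 2 / 2))%R by field.
  by rewrite mulr_ge0 ?divr_ge0 ?sqr_ge0 ?ltW.
Qed.

(** Otherwise [X] would be almost surely nonnegative with a null expectation,
    hence almost surely null. *)
Lemma negative_tail (X : T -> R) : measurable_fun setT X ->
  \int[P]_w (X w)%:E = 0 -> \int[P]_w (X w ^+ 2)%:E != 0 ->
  exists2 a : R, (0 < a)%R & 0 < P [set w | (X w <= - a)%R].
Proof.
move=> mX X0 /eqP X2; apply: contrapT => noa; apply: X2.
have mEX : measurable_fun setT (EFin \o X) by exact/measurable_EFinP.
have Xae : \forall w \ae P, (0 <= X w)%R.
  have : \forall w \ae P, forall n : nat, (- n.+1%:R^-1 < X w)%R.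
    apply: ae_foralln => n; exists [set w | (X w <= - n.+1%:R^-1)%R]; split.
    - by rewrite -[X in measurable X]setTI; exact: measurable_fun_ler.
    - apply/eqP; rewrite -measure_le0 leNgt; apply/negP => PX; apply: noa.
      by exists (n.+1%:R^-1)%R => //; rewrite invr_gt0.
    - by move=> w /= /negP; rewrite -leNgt.
  apply: filterS => w Xn; rewrite leNgt; apply/negP => Xw0.
  have [n] := ltr_add_invr Xw0; rewrite -ltrBrDl sub0r => Xwn.
  by have := Xn n; rewrite ltrNl => /(lt_trans Xwn); rewrite ltxx.
have absX0 : \int[P]_w `|(X w)%:E| = 0.
  rewrite -X0; apply: ae_eq_integral => //; first exact: measurableT_comp.
  by apply: filterS Xae => w Xw0 _; rewrite /= ger0_norm.
have : ae_eq P setT (EFin \o X) (cst 0) by exact/ae_eq_integral_abs.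
move=> Xae0; rewrite -[RHS](integral0 P setT); apply: ae_eq_integral => //.
  by apply/measurable_EFinP; exact: measurable_funX.
by apply: filterS Xae0 => w /(_ Logic.I) [->]; rewrite expr0n.
Qed.

End Moments.

Lemma sqr_exp_integrable_law {R : realType} {d d'} {T : measurableType d}
    {T' : measurableType d'} (P : probability T R) (X : T -> R)
    (Q : probability T' R) (Y : T' -> R) (e : R) :
  measurable_fun setT X -> measurable_fun setT Y -> same_law P X Q Y ->
  sqr_exp_integrable P X e -> sqr_exp_integrable Q Y e.
Proof.
move=> mX mY XY; rewrite /sqr_exp_integrable.
rewrite (same_law_ge0_integral mX mY XY
  (f := fun x => (expR (e * x ^+ 2))%:E))//.
apply/measurable_EFinP; apply: measurableT_comp => //.
by apply: measurable_funM => //; exact: measurable_funX.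
Qed.

Section ExpMoment.
Context {R : realType} {d} {T : measurableType d} (P : probability T R).
Variables (X : T -> R) (mX : measurable_fun setT X).

Lemma integrable_of_exp_abs_bound (f : T -> R) (b : R) :
  measurable_fun setT f ->
  (\int[P]_w (expR (b * `|X w|))%:E < +oo)%E ->
  (forall w, `|f w| <= expR (b * `|X w|)) -> P.-integrable setT (EFin \o f).
Proof.
move=> mf fin fle.
have mE : measurable_fun setT (fun w => (expR (b * `|X w|))%:E).
  apply/measurable_EFinP; apply: measurableT_comp => //.
  by apply: measurable_funM => //; exact: measurableT_comp.
apply: (@le_integrable _ _ _ _ _ _ _ (fun w => (expR (b * `|X w|))%:E)) => //.
- exact/measurable_EFinP.
- by move=> w _ /=; rewrite lee_fin (ger0_norm (expR_ge0 _)).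
- apply/integrableP; split => //.
  under eq_integral do rewrite /= ger0_norm ?expR_ge0//.
  exact: fin.
Qed.

Variables (s C : R).
Hypothesis s_gt0 : 0 < s.
Hypothesis exp_abs_le : (\int[P]_w (expR (2 * s * `|X w|))%:E <= C%:E)%E.

Let exp_abs_lty : (\int[P]_w (expR (2 * s * `|X w|))%:E < +oo)%E.
Proof. exact: le_lt_trans (ltry C). Qed.

Definition exp_moment : R := \int[P]_w expR (s * X w).

Let le_exp_abs (x : R) : expR (s * x) <= expR (2 * s * `|x|).
Proof.
rewrite ler_expR.
have : s * x <= s * `|x| by rewrite ler_wpM2l ?ler_norm ?(ltW s_gt0).
have : 0 <= s * `|x| by rewrite mulr_ge0 ?(ltW s_gt0).
by lra.
Qed.

Let mexp : measurable_fun setT (fun w => expR (s * X w)).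
Proof. by apply: measurableT_comp => //; exact: measurable_funM. Qed.

Let integrable_exp : P.-integrable setT (EFin \o (fun w => expR (s * X w))).
Proof.
apply: (integrable_of_exp_abs_bound mexp exp_abs_lty) => w.
by rewrite ger0_norm ?expR_ge0.
Qed.

Lemma exp_momentE : (\int[P]_w (expR (s * X w))%:E = exp_moment%:E)%E.
Proof. by rewrite /exp_moment /Rintegral fineK// integrable_fin_num. Qed.

Lemma exp_moment_le : exp_moment <= C.
Proof.
rewrite -lee_fin -exp_momentE; apply: le_trans exp_abs_le.
apply: ge0_le_integral => //.
- exact/measurable_EFinP.
- apply/measurable_EFinP; apply: measurableT_comp => //.
  by apply: measurable_funM => //; exact: measurableT_comp.
- by move=> w _; rewrite lee_fin.
Qed.

Hypothesis X_mean0 : (\int[P]_w (X w)%:E = 0)%E.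

Lemma integrable_scaled : P.-integrable setT (EFin \o (fun w => s * X w)).
Proof.
apply: (integrable_of_exp_abs_bound _ exp_abs_lty).
  exact: measurable_funM.
move=> w; apply: le_trans (expR_ge1Dx _); rewrite normrM gtr0_norm//.
have : 0 <= s * `|X w| by rewrite mulr_ge0// ltW.
by lra.
Qed.

Lemma Rintegral_scaled_mean0 : \int[P]_w (s * X w) = 0.
Proof.
have iX : P.-integrable setT (EFin \o X).
  apply: (@eq_integrable _ _ _ P setT measurableT _ _ _
    (integrableZl measurableT s^-1 integrable_scaled)).
  by move=> w _ /=; rewrite -EFinM mulKf ?gt_eqF.
by rewrite RintegralZl// /Rintegral X_mean0 mulr0.
Qed.

Lemma exp_moment_ge1 : 1 <= exp_moment.
Proof.
have i1 : P.-integrable setT (EFin \o cst 1).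
  exact: finite_measure_integrable_cst.
have -> : 1 = \int[P]_w (1 + s * X w).
  rewrite RintegralD//; last exact: integrable_scaled.
  rewrite Rintegral_scaled_mean0 addr0 (Rintegral_cst P)// mul1r.
  by rewrite (congr1 fine (probability_setT P)).
apply: le_Rintegral => //.
  exact: (integrableD measurableT i1 integrable_scaled).
by move=> w _; exact: expR_ge1Dx.
Qed.

End ExpMoment.

(** * The expected leave-one-out loss of an i.i.d. sample *)

Section MeanLooLoss.
Context {R : realType} {N : nat} (N_ge2 : (2 <= N)%N).
Context {dS} {S : measurableType dS} (Q : probability S R).
Context {dXi} {Xi : measurableType dXi} (Pxi : probability Xi R).
Variables (xi : Xi -> R) (zeta : 'I_N -> S -> R).
Hypothesis mxi : measurable_fun setT xi.
Hypothesis mzeta : forall i, measurable_fun setT (zeta i).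
Hypothesis law : forall i, same_law Q (zeta i) Pxi xi.
Variables (s C : R).
Hypothesis s_gt0 : 0 < s.
Hypothesis exp_abs_le : (\int[Pxi]_w (expR (2 * s * `|xi w|))%:E <= C%:E)%E.

Let loss i w := loo_loss (fun j => s * zeta j w) i.

Lemma measurable_loo_loss i : measurable_fun setT (loss i).
Proof.
have me j : measurable_fun setT (fun w => expR (s * zeta j w)).
  by apply: measurableT_comp => //; exact: measurable_funM.
pose M w := loo_mean_exp (fun j => s * zeta j w) i.
have mM : measurable_fun setT M.
  apply: measurable_funM => //; under eq_fun do rewrite big_mkcond.
  apply: (@measurable_sum _ _ _ _ _ _
    (fun j w => if j != i then expR (s * zeta j w) else 0)) => j.
  by case: (j != i).
have ml : measurable_fun setT (fun w => ln (M w)) by exact: measurableT_comp.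
(* The quotient is an exponential, which avoids the inverse function. *)
have -> : loss i = fun w => ln (M w) + expR (s * zeta i w - ln (M w)) - 1.
  apply/funext => w; rewrite /loss /loo_loss expRD expRN lnK//.
  by rewrite posrE loo_mean_exp_gt0.
apply: measurable_funB => //; apply: measurable_funD => //.
apply: measurableT_comp => //; apply: measurable_funB => //.
exact: measurable_funM.
Qed.

Let mexp_abs : measurable_fun setT (fun x : R => (expR (2 * s * `|x|))%:E).
Proof.
apply/measurable_EFinP; apply: measurableT_comp => //.
by apply: measurable_funM => //; exact: measurableT_comp.
Qed.

Let mexp_abs_zeta j :
  measurable_fun setT (fun w => (expR (2 * s * `|zeta j w|))%:E).
Proof. exact: (measurableT_comp mexp_abs (mzeta j)). Qed.

Let zeta_exp_abs j : (\int[Q]_w (expR (2 * s * `|zeta j w|))%:E =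
  \int[Pxi]_w (expR (2 * s * `|xi w|))%:E)%E.
Proof. exact: (same_law_ge0_integral (mzeta j) mxi (law j) mexp_abs). Qed.

Lemma integral_norm_loo_loss_le i :
  (\int[Q]_w `|(loss i w)%:E| <= ((N%:R + 3) * N%:R * C)%:E)%E.
Proof.
have normz j w : 2 * `|s * zeta j w| = 2 * s * `|zeta j w|.
  by rewrite normrM (gtr0_norm s_gt0) mulrA.
apply: (@le_trans _ _ (\int[Q]_w ((N%:R + 3)%:E *
   \sum_(j < N) (expR (2 * s * `|zeta j w|))%:E)))%E.
  apply: ge0_le_integral => //.
  - apply: measurableT_comp => //.
    by apply/measurable_EFinP; exact: measurable_loo_loss.
  - by apply: emeasurable_funM => //; exact: emeasurable_sum.
  - move=> w _; rewrite sumEFin -EFinM lee_fin.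
    apply: le_trans (loo_loss_abs_le N_ge2 _ i) _.
    by under eq_bigr do rewrite normz.
rewrite ge0_integralZl_EFin//; last 2 first.
- by move=> w _; apply: sume_ge0.
- exact: emeasurable_sum.
rewrite ge0_integral_sum// (eq_bigr _ (fun j _ => zeta_exp_abs j)).
rewrite sumr_const card_ord.
apply: (@le_trans _ _ (((N%:R + 3) * N%:R)%:E *
  \int[Pxi]_w (expR (2 * s * `|xi w|))%:E))%E.
  by rewrite EFinM -muleA mule_natl.
by rewrite [leRHS]EFinM lee_wpmul2l// lee_fin mulr_ge0// addr_ge0.
Qed.

Lemma integrable_loo_loss i : Q.-integrable setT (EFin \o loss i).
Proof.
apply/integrableP; split.
  by apply/measurable_EFinP; exact: measurable_loo_loss.
exact: le_lt_trans (integral_norm_loo_loss_le i) (ltry _).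
Qed.

Hypothesis indep : forall B : 'I_N -> set R, (forall i, measurable (B i)) ->
  (Q (\bigcap_i (zeta i @^-1` B i)) = \prod_i Q (zeta i @^-1` B i))%E.
Hypothesis xi_mean0 : (\int[Pxi]_w (xi w)%:E = 0)%E.

Lemma indep_other_tails (i : 'I_N) (a : R) (A : set R) : measurable A ->
  (Q (zeta i @^-1` A `&` [set w | forall k, k != i -> (zeta k w <= - a)%R]) =
   Q (zeta i @^-1` A) *
   (fine (Pxi [set w | (xi w <= - a)%R]) ^+ N.-1)%:E)%E.
Proof.
move=> mA.
have mtail : measurable [set x : R | x <= - a].
  by rewrite -[X in measurable X]setTI; exact: measurable_fun_ler.
pose B k := if k == i then A else [set x | x <= - a].
have mB k : measurable (B k) by rewrite /B; case: ifP.
have -> : zeta i @^-1` A `&` [set w | forall k, k != i -> zeta k w <= - a] =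
    \bigcap_k (zeta k @^-1` B k).
  apply/seteqP; split => w /=.
    move=> [Aw tw] k _ /=; rewrite /B; case: ifPn => [/eqP -> //|ki].
    exact: tw.
  move=> Bw; split; first by have := Bw i Logic.I; rewrite /= /B eqxx.
  by move=> k ki; have := Bw k Logic.I; rewrite /= /B (negbTE ki).
rewrite indep// (bigD1 i)//= {1}/B eqxx; congr (_ * _)%E.
rewrite (eq_bigr (fun=> (fine (Pxi [set w | xi w <= - a]))%:E)) => [|k ki].
  by rewrite prodEFin prodr_const cardC1 card_ord.
rewrite /B (negbTE ki) fineK ?fin_num_measure//; first exact: law.
by rewrite -[X in measurable X]setTI; exact: (mxi measurableT mtail).
Qed.

Let m := exp_moment Pxi xi s.

(** The loss dominates [D1 + D2], where [D1] has expectation [- N] and [D2] is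
    [exp (s * a)] times [exp (s * zeta i)] on the event that all the other
    samples are at most [- a]; by independence the expectation of [D2] is a
    product. *)
Lemma Rintegral_loo_loss_ge i (a : R) :
  m * fine (Pxi [set w | xi w <= - a]) ^+ N.-1 * expR (s * a) - N%:R <=
  \int[Q]_w loss i w.
Proof.
have [j ji] := other_index N_ge2 i.
set q := fine _.
pose B := [set w | forall k, k != i -> zeta k w <= - a].
have mtail : measurable [set x : R | x <= - a].
  by rewrite -[X in measurable X]setTI; exact: measurable_fun_ler.
have mB : measurable B.
  rewrite (_ : B = \bigcap_(k in [set k | k != i])
      (zeta k @^-1` [set x | x <= - a])).
    apply: fin_bigcap_measurable => [|k _]; first exact: finite_finset.
    by rewrite -[X in measurable X]setTI; exact: (mzeta k measurableT mtail).
  by apply/seteqP; split.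
have QB : Q B = (q ^+ N.-1)%:E.
  have := indep_other_tails i a measurableT.
  by rewrite setTI preimage_setT probability_setT mul1e.
have mes : measurable_fun setT (fun x : R => (expR (s * x))%:E).
  by apply/measurable_EFinP; apply: measurableT_comp.
pose g w := (expR (s * zeta i w))%:E.
have mg : measurable_fun setT g by exact: (measurableT_comp mes (mzeta i)).
have gB : (\int[Q]_(w in B) g w = (m * q ^+ N.-1)%:E)%E.
  rewrite (integral_indep_event (mzeta i) mB mes)//; last first.
    by move=> A mA; rewrite indep_other_tails// QB.
  rewrite (same_law_ge0_integral (mzeta i) mxi (law i) mes)// QB.
  by rewrite (exp_momentE mxi s_gt0 exp_abs_le).
pose D1 w := s * zeta j w - N%:R.
pose D2 w := expR (s * zeta i w) *
  (if [forall k, (k != i) ==> (s * zeta k w <= - (s * a))]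
   then expR (s * a) else 0).
have D2E w : (D2 w)%:E = ((expR (s * a))%:E * (g \_ B) w)%E.
  rewrite /D2 patchE; case: ifPn => [/forallP tw|tw].
    rewrite mem_set ?EFinM 1?muleC// => k ki.
    by have := implyP (tw k) ki; rewrite -mulrN ler_pM2l.
  rewrite memNset ?mulr0 ?mule0// => tw'; move/negP : tw; apply.
  apply/forallP => k; apply/implyP => ki.
  by rewrite -mulrN ler_pM2l// tw'.
have mgB : measurable_fun setT (g \_ B).
  by apply/(measurable_restrictT _ _).1 => //; exact: measurable_funTS.
have intD2 : (\int[Q]_w (D2 w)%:E = (m * q ^+ N.-1 * expR (s * a))%:E)%E.
  under eq_integral do rewrite D2E.
  rewrite ge0_integralZl_EFin ?expR_ge0//.
    by rewrite -integral_mkcond gB -EFinM mulrC.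
  by move=> w _; rewrite patchE; case: ifP => // _; rewrite lee_fin expR_ge0.
have iD2 : Q.-integrable setT (EFin \o D2).
  apply/integrableP; split.
    rewrite (_ : EFin \o D2 = fun w => (expR (s * a))%:E * (g \_ B) w)%E.
      exact: emeasurable_funM.
    by apply/funext => w; exact: D2E.
  under eq_integral => w _.
    rewrite /= ger0_norm; last first.
      by rewrite mulr_ge0 ?expR_ge0//; case: ifP => // _; exact: expR_ge0.
    over.
  by rewrite intD2 ltry.
have zeta_mean0 : (\int[Q]_w (zeta j w)%:E = 0)%E.
  have mE : measurable_fun setT (EFin : R -> \bar R).
    by apply/measurable_EFinP; exact: measurable_id.
  by rewrite (same_law_integral (mzeta j) mxi (law j) mE).
have exp_abs_zeta : (\int[Q]_w (expR (2 * s * `|zeta j w|))%:E <= C%:E)%E.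
  by rewrite zeta_exp_abs.
have isz := integrable_scaled (mzeta j) s_gt0 exp_abs_zeta.
have iN : Q.-integrable setT (EFin \o cst N%:R).
  exact: finite_measure_integrable_cst.
have iD1 : Q.-integrable setT (EFin \o D1).
  exact: (integrableB measurableT isz iN).
have intD1 : \int[Q]_w D1 w = - N%:R.
  rewrite /D1 RintegralB//.
  rewrite (Rintegral_scaled_mean0 (mzeta j) s_gt0 exp_abs_zeta zeta_mean0).
  rewrite (Rintegral_cst Q)// (_ : fine _ = 1) ?mulr1 ?sub0r//.
  exact: (congr1 fine (probability_setT Q)).
have -> : m * q ^+ N.-1 * expR (s * a) - N%:R = \int[Q]_w (D1 w + D2 w).
  by rewrite RintegralD// intD1 /Rintegral intD2/= addrC.
apply: le_Rintegral => //.
- exact: (integrableD measurableT iD1 iD2).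
- exact: integrable_loo_loss.
- by move=> w _; exact: loo_loss_ge.
Qed.

Definition mean_loo_loss : R := N%:R^-1 * \sum_(i < N) \int[Q]_w loss i w.

Let N_gt0 : 0 < N%:R :> R.
Proof. by rewrite ltr0n; case: N N_ge2. Qed.

Lemma mean_loo_loss_ge (a : R) :
  m * fine (Pxi [set w | xi w <= - a]) ^+ N.-1 * expR (s * a) - N%:R
  <= mean_loo_loss.
Proof.
rewrite /mean_loo_loss ler_pdivlMl// mulr_natl.
rewrite -[X in _ *+ X](card_ord N) -sumr_const; apply: ler_sum => i _.
exact: Rintegral_loo_loss_ge.
Qed.

Lemma mean_loo_loss_abs_le : `|mean_loo_loss| <= (N%:R + 3) * N%:R * C.
Proof.
rewrite /mean_loo_loss normrM ger0_norm ?invr_ge0// ler_pdivrMl//.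
rewrite mulr_natl -[X in _ *+ X](card_ord N) -sumr_const.
apply: le_trans (ler_norm_sum _ _ _) _; apply: ler_sum => i _.
rewrite -lee_fin EFin_normr_Rintegral//; last exact: integrable_loo_loss.
apply: le_trans (integral_norm_loo_loss_le i).
apply: le_abse_integral => //.
by apply/measurable_EFinP; exact: measurable_loo_loss.
Qed.

(** With [x = q ^+ N.-1 * expR (s * a)], the gap is at least
    [m * x - N - ln m >= m * (x - 1) - N + 1 >= x - N], because [m >= 1]. *)
Lemma loo_gap_ge (a q : R) : 0 < q -> fine (Pxi [set w | xi w <= - a]) = q ->
  2 * N%:R <= q ^+ N.-1 * expR (s * a) ->
  q ^+ N.-1 / 2 * expR (s * a) <= `|ln m - mean_loo_loss|.
Proof.
move=> q0 qE large; have := mean_loo_loss_ge a; rewrite qE -mulrA.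
have N1 : 1 <= N%:R :> R by rewrite ler1n; case: N N_ge2.
set x := _ * expR _ in large * => Lge.
have m1 : 1 <= m := exp_moment_ge1 mxi s_gt0 exp_abs_le xi_mean0.
have lnm : ln m <= m - 1.
  by have := @le_ln1Dx R (m - 1); rewrite [1 + _]addrC subrK => -> //; lra.
have : 0 <= (m - 1) * (x - 1) by rewrite mulr_ge0//; lra.
rewrite distrC mulrAC -/x => mx.
by apply: le_trans (ler_norm _); nra.
Qed.

Lemma loo_gap_le : `|ln m - mean_loo_loss| <= ((N%:R + 3) * N%:R + 1) * C.
Proof.
have m1 : 1 <= m := exp_moment_ge1 mxi s_gt0 exp_abs_le xi_mean0.
have mC : m <= C := exp_moment_le mxi s_gt0 exp_abs_le.
apply: le_trans (ler_normB _ _) _; rewrite mulrDl mul1r addrC.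
apply: lerD; first exact: mean_loo_loss_abs_le.
rewrite ger0_norm ?ln_ge0//; apply: le_trans mC; apply/ltW/ln_sublinear.
exact: lt_le_trans m1.
Qed.

End MeanLooLoss.

(** * Location-scale families *)

Section LocationScale.
Context {R : realType} {d} {T : measurableType d} (P : probability T R).
Context {dXi} {Xi : measurableType dXi} (Pxi : probability Xi R).
Variables (X : T -> R) (xi : Xi -> R) (mu sigma : R).
Hypotheses (mX : measurable_fun setT X) (mxi : measurable_fun setT xi).
Hypothesis law : same_law P X Pxi (fun w => mu + sigma * xi w).
Hypothesis xi_mean0 : (\int[Pxi]_w (xi w)%:E = 0)%E.
Hypothesis xi_var1 : (\int[Pxi]_w (xi w ^+ 2)%:E = 1)%E.

Let maff : measurable_fun setT (fun w => mu + sigma * xi w).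
Proof. by apply: measurable_funD => //; exact: measurable_funM. Qed.

Let integrable_xi : Pxi.-integrable setT (EFin \o xi).
Proof.
have m2 : measurable_fun setT (fun w => (xi w ^+ 2)%:E).
  by apply/measurable_EFinP; exact: measurable_funX.
have i2 : Pxi.-integrable setT (EFin \o (fun w => 1 + xi w ^+ 2)).
  apply: (@integrableD _ _ _ Pxi setT measurableT (EFin \o cst 1)
    (fun w => (xi w ^+ 2)%:E)); first exact: finite_measure_integrable_cst.
  apply/integrableP; split => //.
  under eq_integral do rewrite /= ger0_norm ?sqr_ge0//.
  by rewrite xi_var1 ltry.
apply: (le_integrable measurableT _ _ i2); first exact/measurable_EFinP.
move=> w _ /=; rewrite lee_fin [leRHS]ger0_norm ?addr_ge0 ?sqr_ge0//.
rewrite -[xi w ^+ 2]real_normK ?num_real//.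
by have := sqr_ge0 (`|xi w| - 1); have := normr_ge0 (xi w); nra.
Qed.

Lemma location_scale_mean : ('E_P[X] = mu%:E)%E.
Proof.
rewrite unlock.
have mE : measurable_fun setT (EFin : R -> \bar R).
  by apply/measurable_EFinP; exact: measurable_id.
rewrite (same_law_integral mX maff law mE).
have -> : (\int[Pxi]_w (mu + sigma * xi w)%:E =
           \int[Pxi]_w ((cst mu w)%:E + (sigma%:E * (xi w)%:E)))%E by [].
rewrite integralD//; last 2 first.
- exact: finite_measure_integrable_cst.
- exact: integrableZl.
have := expectation_cst Pxi mu; rewrite unlock => ->.
by rewrite integralZl// xi_mean0 mule0 adde0.
Qed.

Lemma location_scale_variance : ('V_P[X] = (sigma ^+ 2)%:E)%E.
Proof.
rewrite /variance covariance.unlock location_scale_mean/= expectation.unlock.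
have mf : measurable_fun setT (fun x : R => ((x - mu) * (x - mu))%:E).
  apply/measurable_EFinP; apply: measurable_funM; exact: measurable_funB.
have /= -> := same_law_integral mX maff law mf.
transitivity (\int[Pxi]_w ((sigma ^+ 2)%:E * (xi w ^+ 2)%:E))%E.
  by apply: eq_integral => w _; rewrite -EFinM; congr EFin; ring.
rewrite ge0_integralZl_EFin ?sqr_ge0// ?xi_var1 ?mule1//.
- by move=> w _; rewrite lee_fin sqr_ge0.
- by apply/measurable_EFinP; exact: measurable_funX.
Qed.

Lemma location_scale_entropic_risk (alpha : R) : 0 < alpha ->
  forall m, 0 < m ->
  (\int[Pxi]_w (expR (alpha * sigma * xi w))%:E = m%:E)%E ->
  entropic_risk alpha P X = (mu + alpha^-1 * ln m)%:E.
Proof.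
move=> a0 m m0 mE; rewrite /entropic_risk unlock.
have mf : measurable_fun setT (fun x : R => (expR (alpha * x))%:E).
  by apply/measurable_EFinP; exact: measurableT_comp.
rewrite (same_law_integral mX maff law mf).
have -> : (\int[Pxi]_w (expR (alpha * (mu + sigma * xi w)))%:E =
           (expR (alpha * mu) * m)%:E)%E.
  transitivity (\int[Pxi]_w ((expR (alpha * mu))%:E *
      (expR (alpha * sigma * xi w))%:E))%E.
    by apply: eq_integral => w _; rewrite -EFinM -expRD mulrDr mulrA.
  rewrite ge0_integralZl_EFin ?expR_ge0// ?mE//.
  apply/measurable_EFinP; apply: measurableT_comp => //.
  exact: measurable_funM.
rewrite lne_EFin ?mulr_gt0 ?expR_gt0// lnM ?posrE ?expR_gt0// expRK -EFinM.
by rewrite mulrDr mulKf ?gt_eqF.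
Qed.

End LocationScale.

Lemma expectation_rho_loocv {R : realType} (alpha : R) {N : nat} {d}
    {E : measurableType d} {dS} {S : measurableType dS} (Q : probability S R)
    (X : E -> R) (etah : 'I_N -> S -> E) (zeta : 'I_N -> S -> R) (mu sigma : R) :
  0 < alpha -> (2 <= N)%N -> measurable_fun setT X ->
  (forall i w, X (etah i w) = mu + sigma * zeta i w) ->
  (forall i, Q.-integrable setT
     (EFin \o (fun w => loo_loss (fun j => alpha * sigma * zeta j w) i))) ->
  'E_Q[fun w => rho_loocv alpha X (etah ^~ w)]%E =
  (mu + alpha^-1 * mean_loo_loss Q zeta (alpha * sigma))%:E.
Proof.
move=> a0 N2 mX XE iL; rewrite unlock.
have N0 : N%:R != 0 :> R by rewrite pnatr_eq0; case: N N2 {iL XE zeta etah}.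
set L := fun (i : 'I_N) w =>
  loo_loss (fun j => alpha * sigma * zeta j w) i in iL *.
have rhoE w : (rho_loocv alpha X (etah ^~ w))%:E =
    ((cst mu w)%:E + (alpha^-1 * N%:R^-1)%:E * \sum_(i < N) (L i w)%:E)%E.
  rewrite rho_loocvE// sumEFin -EFinM -EFinD; congr EFin.
  have -> : (fun j => alpha * X (etah j w)) =
      (fun j => alpha * mu + alpha * sigma * zeta j w).
    by apply/funext => j; rewrite XE mulrDr mulrA.
  rewrite (eq_bigr (fun i => alpha * mu + L i w)); last first.
    by move=> i _; exact: loo_loss_shift.
  rewrite big_split/= sumr_const card_ord -[alpha * mu *+ _]mulr_natl !mulrDr.
  by rewrite mulKf// mulKf ?gt_eqF// mulrA.
under eq_integral do rewrite rhoE.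
have iS : Q.-integrable setT (fun w => (\sum_(i < N) (L i w)%:E)%E).
  apply: (@integrable_sum _ _ _ Q setT measurableT _ _ _
    (fun i w => (L i w)%:E)) => i _; exact: iL.
rewrite integralD//; last 2 first.
- exact: finite_measure_integrable_cst.
- exact: integrableZl.
have := expectation_cst Q mu; rewrite unlock => ->.
rewrite integralZl// integral_sum//.
rewrite EFinD; congr (_ + _)%E; rewrite /mean_loo_loss mulrA [RHS]EFinM -sumEFin.
congr (_ * _)%E; apply: eq_bigr => i _.
rewrite /Rintegral fineK//; exact: (integrable_fin_num measurableT (iL i)).
Qed.

Theorem proposition8 (R : realType) (alpha : R) (alpha_gt0 : 0 < alpha)
    (N : nat) (N_ge2 : (2 <= N)%N)
    (dXi : measure_display) (Xi : measurableType dXi)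
    (Pxi : probability Xi R) (xi : {RV Pxi >-> R}) :
  exists k1 k2 : R, 0 < k1 /\ 0 < k2 /\
  exists c1 s1 c2 s2 : R, 0 < c1 /\ 0 < s1 /\ 0 < c2 /\ 0 < s2 /\
  forall (d m : nat) (P : probability (m.-tuple R) R)
    (Z : set 'rV[R]_d) (ell : 'rV[R]_d -> m.-tuple R -> R) (A : set (R * R))
    (dS : measure_display) (S : measurableType dS) (Q : probability S R)
    (etah : 'I_N -> {RV Q >-> m.-tuple R}),
  (forall z, Z z -> measurable_fun setT (ell z)) ->
  location_scale P Z ell Pxi xi A ->
  (forall z, Z z -> subgaussian_tails P (ell z)) ->
  iid_samples P etah ->
  forall z, Z z ->
  let sigma := Num.sqrt (fine ('V_P[ell z])%E) in
  let gap := (`| entropic_risk alpha P (ell z)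
                 - 'E_Q[fun w => rho_loocv alpha (ell z) (etah ^~ w)] |)%E in
  (s1 <= sigma -> ((c1 * expR (k1 * sigma))%:E <= gap)%E) /\
  (s2 <= sigma -> (gap <= (c2 * expR (k2 * fine ('V_P[ell z])%E))%:E)%E).
Proof.
have mxi : measurable_fun setT (xi : Xi -> R) by exact: measurable_funP.
(* The constants have to be fixed before the hypotheses on xi are known; they
   take an arbitrary value when these fail. *)
have [a [q [a0 q0 qE]]] : exists a q : R, [/\ 0 < a, 0 < q &
    (\int[Pxi]_w (xi w)%:E = 0)%E -> (\int[Pxi]_w (xi w ^+ 2)%:E = 1)%E ->
    fine (Pxi [set w | xi w <= - a]) = q].
  have [[xi0 xi2]|nxi] := pselect ((\int[Pxi]_w (xi w)%:E = 0)%E /\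
      (\int[Pxi]_w (xi w ^+ 2)%:E = 1)%E); last first.
    by exists 1, 1; split => // xi0 xi2; case: nxi.
  have xi2_neq0 : (\int[Pxi]_w (xi w ^+ 2)%:E != 0)%E by rewrite xi2 onee_neq0.
  have [a a0 aP] := negative_tail mxi xi0 xi2_neq0.
  exists a, (fine (Pxi [set w | xi w <= - a])); split => //.
  apply: fine_gt0; rewrite aP/= (le_lt_trans (probability_le1 Pxi _)) ?ltry//.
  by rewrite -[X in measurable X]setTI; exact: measurable_fun_ler.
have [e [K [e0 K0 eK]]] : exists e K : R, [/\ 0 < e, 0 < K &
    (exists2 e', 0 < e' & sqr_exp_integrable Pxi xi e') ->
    (\int[Pxi]_w (expR (e * xi w ^+ 2))%:E <= K%:E)%E].
  have [[e e0 eP]|ne] := pselect (exists2 e', 0 < e' &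
      sqr_exp_integrable Pxi xi e'); last by exists 1, 1; split => // /ne.
  exists e, (fine (\int[Pxi]_w (expR (e * xi w ^+ 2))%:E)%E + 1); split => //.
    by rewrite ltr_wpDl// fine_ge0// integral_ge0.
  move=> _; rewrite EFinD fineK ?leeDl//.
  by rewrite ge0_fin_numE// integral_ge0// => w _; rewrite lee_fin expR_ge0.
have qN0 : 0 < q ^+ N.-1 by rewrite exprn_gt0.
have N0 : 0 < N%:R :> R by rewrite ltr0n; case: (N) N_ge2.
have s1_gt0 : 0 < 2 * N%:R / (q ^+ N.-1 * (alpha * a)).
  by rewrite divr_gt0 ?mulr_gt0.
have ia0 : 0 < alpha^-1 by rewrite invr_gt0.
exists (alpha * a), (alpha ^+ 2 / e); split; first by rewrite mulr_gt0.
split; first by rewrite divr_gt0// exprn_gt0.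
(* Past the first threshold, exp x >= x gives the largeness condition
   2 N <= q ^ (N - 1) exp (alpha a sigma) of the lower bound. *)
exists (alpha^-1 * (q ^+ N.-1 / 2)), (2 * N%:R / (q ^+ N.-1 * (alpha * a))).
exists (alpha^-1 * (((N%:R + 3) * N%:R + 1) * K)), 1.
split; first by rewrite !mulr_gt0.
split=> //.
split; first by rewrite !mulr_gt0// addr_gt0// mulr_gt0// addr_gt0.
split=> // d n P Z ell A dS S Q etah mell [xi0 xi2 A0 laws] sg [idd indep] z Zz.
rewrite unlock in xi0 xi2.
have mX := mell z Zz.
have : [set borel_law P (ell z') | z' in Z] (borel_law P (ell z)) by exists z.
rewrite laws => -[[mu sigma] /A0 /= s0 lawz].
have law : same_law P (ell z) Pxi (fun w => mu + sigma * xi w).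
  by move=> B mB; have := congr1 (fun f => f (exist _ B mB)) lawz.
cbv zeta; rewrite (location_scale_variance mX mxi law xi0 xi2)/=.
rewrite sqrtr_sqr ger0_norm//.
(* A degenerate loss has a null standard deviation, below both thresholds. *)
have [sigma0|sigma_le0] := ltP 0 sigma; last first.
  split=> /le_trans/(_ sigma_le0) bad.
    by have := lt_le_trans s1_gt0 bad; rewrite ltxx.
  by have := lt_le_trans ltr01 bad; rewrite ltxx.
pose zeta (i : 'I_N) (w : S) := (ell z (etah i w) - mu) / sigma.
have XE i w : ell z (etah i w) = mu + sigma * zeta i w.
  by rewrite /zeta mulrC mulfVK ?gt_eqF// addrC subrK.
have mstd : measurable_fun setT (fun x => (ell z x - mu) / sigma).
  by apply: measurable_funM => //; exact: measurable_funB.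
have mzeta i : measurable_fun setT (zeta i).
  by apply: (measurableT_comp mstd).
have mstdB B : measurable B ->
    measurable ((fun x => (ell z x - mu) / sigma) @^-1` B).
  by move=> mB; rewrite -[X in measurable X]setTI; exact: mstd.
have lawzeta i : same_law Q (zeta i) Pxi xi.
  move=> B mB; have := idd i _ (mstdB B mB).
  rewrite /distribution /pushforward => ->.
  pose C := (fun x : R => (x - mu) / sigma) @^-1` B.
  have mC : measurable C.
    rewrite -[X in measurable X]setTI; apply: (_ : measurable_fun setT _) => //.
    by apply: measurable_funM => //; exact: measurable_funB.
  have := law C mC; rewrite /C /preimage /= => ->; congr (Pxi _).
  apply/seteqP; split => w /=;
    by rewrite addrAC subrr add0r mulrC mulKf ?gt_eqF.
have indepzeta (B : 'I_N -> set R) : (forall i, measurable (B i)) ->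
    (Q (\bigcap_i (zeta i @^-1` B i)) = \prod_i Q (zeta i @^-1` B i))%E.
  by move=> mB; exact: (indep (fun i => _ @^-1` B i) (fun i => mstdB _ (mB i))).
pose s := alpha * sigma; pose m := exp_moment Pxi xi s.
have s_gt0 : 0 < s by rewrite mulr_gt0.
pose C := K * expR (alpha ^+ 2 / e * sigma ^+ 2).
have exp_abs_le : (\int[Pxi]_w (expR (2 * s * `|xi w|))%:E <= C%:E)%E.
  apply: le_trans (exp_abs_moment_le _ _ mxi e0) _.
  have -> : (2 * s) ^+ 2 / (4 * e) = alpha ^+ 2 / e * sigma ^+ 2.
    by rewrite /s; field; rewrite gt_eqF.
  rewrite /C [K * _]mulrC EFinM lee_wpmul2l ?lee_fin ?expR_ge0// eK//.
  have [e' e'0 e'P] := subgaussian_sqr_exp mX (sg z Zz).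
  exists (e' * sigma ^+ 2 / 2); first by rewrite !mulr_gt0// exprn_gt0.
  apply: sqr_exp_integrable_affine (sqr_exp_integrable_law mX _ law e'P) => //.
  by apply: measurable_funD => //; exact: measurable_funM.
have m_gt0 : 0 < m.
  exact: lt_le_trans (exp_moment_ge1 mxi s_gt0 exp_abs_le xi0).
rewrite (location_scale_entropic_risk mX mxi law alpha_gt0 m_gt0); last first.
  exact: (exp_momentE mxi s_gt0 exp_abs_le).
rewrite [X in (_ - X)%E](_ : _ =
    (mu + alpha^-1 * mean_loo_loss Q zeta s)%:E)%E; last first.
  apply: (expectation_rho_loocv alpha_gt0 N_ge2 mX XE) => i.
  exact: (integrable_loo_loss N_ge2 mxi mzeta lawzeta s_gt0 exp_abs_le).
rewrite -EFinB /=.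
have -> : mu + alpha^-1 * ln m - (mu + alpha^-1 * mean_loo_loss Q zeta s) =
    alpha^-1 * (ln m - mean_loo_loss Q zeta s) by ring.
rewrite normrM gtr0_norm// !lee_fin; split => [large|_].
  rewrite -[leLHS]mulrA ler_pM2l// [alpha * a * sigma]mulrAC -/s.
  apply: (loo_gap_ge N_ge2 mxi mzeta lawzeta s_gt0 exp_abs_le indepzeta xi0 q0
    (qE xi0 xi2)).
  move: large; rewrite ler_pdivrMr ?mulr_gt0// => /le_trans; apply.
  rewrite mulrCA ler_pM2l// mulrCA mulrA -/s.
  by apply: le_trans (expR_ge1Dx _); rewrite lerDr.
rewrite -[leRHS]mulrA ler_pM2l//.
apply: le_trans (loo_gap_le N_ge2 mxi mzeta lawzeta s_gt0 exp_abs_le xi0) _.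
by rewrite /C mulrA.
Qed.
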